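(* Let $\Gamma$ be a compact Lie subgroup of $\mathbf{O}(2)$ acting on $\mathbb{R}^2$ in the standard way, let $\eta:\Gamma\to\mathbf{Z}_2=\{\pm1\}$ be a group homomorphism, and let $\omega=a(x,y)\,dy^2+2b(x,y)\,dx\,dy+c(x,y)\,dx^2$, with $a,b,c:\mathbb{R}^2\to\mathbb{R}$ of class $C^\infty$, be a $\Gamma_\eta$-equivariant quadratic differential form such that $\Omega=\{(x,y)\in\mathbb{R}^2:\delta(x,y)>0\}$ is non-empty, where $\delta=b^2-ac$. Let $\lambda:\Gamma\to\mathbf{Z}_2=\{\pm1\}$ be the group homomorphism with $\lambda(\gamma)=1$ if $\gamma$ preserves each of the two solution foliations $\mathscr{F}_1,\mathscr{F}_2$ of $\omega=0$ on $\Omega$, and $\lambda(\gamma)=-1$ if $\gamma$ interchanges them. Then, for all $\gamma\in\Gamma$, $$\lambda(\gamma)=\det(\gamma)\,\eta(\gamma).$$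
   Context: The form $\omega$ is viewed as a function on the tangent bundle of $\mathbb{R}^2$: for $u=(x,y)\in\mathbb{R}^2$ and a tangent vector $v=(dx,dy)$ at $u$, $\omega(u,v)=a(u)\,dy^2+2b(u)\,dx\,dy+c(u)\,dx^2$. The group $\Gamma$ acts on the tangent bundle by $\gamma\cdot(u,v)=(\gamma u,\gamma v)$. The form $\omega$ is called $\Gamma_\eta$-equivariant if $\omega(\gamma u,\gamma v)=\eta(\gamma)\,\omega(u,v)$ for all $\gamma\in\Gamma$ and all $u,v$. (The binary differential equation $\omega=0$ is then said to be $\Gamma$-invariant.) The set $\Omega$ is $\Gamma$-invariant. At each point of $\Omega$ the equation $\omega=0$ defines a pair of transverse directions, and so two transverse foliations $\mathscr{F}_1,\mathscr{F}_2$ of $\Omega$, whose leaves are the (non-oriented) solution curves. The labelling is fixed by the vector fields $$X_i(x,y)=\bigl(a(x,y),\,-b(x,y)+(-1)^i\sqrt{\delta(x,y)}\bigr),\qquad i=1,2:$$ $\mathscr{F}_i$ is tangent to $X_i$ wherever $X_i\neq 0$. At each point of $\Omega$ at most one of $X_1,X_2$ vanishes; if $X_i$ vanishes at a point, the direction of $\mathscr{F}_i$ there is the solution direction other than that of the nonvanishing $X_j$, $j\ne i$. The homomorphism $\lambda$ is defined by $\lambda(\gamma)=1$ if $\gamma(\mathscr{F}_i)=\mathscr{F}_i$ for $i=1,2$, and $\lambda(\gamma)=-1$ if $\gamma(\mathscr{F}_i)=\mathscr{F}_j$ for $i\neq j$, $i,j\in\{1,2\}$. *)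

(* Defs.v *)
From HB Require Import structures.
From mathcomp Require Import all_boot all_order all_algebra.
From mathcomp Require Import all_classical all_reals all_analysis.
Set Implicit Arguments.
Unset Strict Implicit.
Unset Printing Implicit Defensive.
Import Order.TTheory GRing.Theory Num.Theory.
Import numFieldNormedType.Exports.
Local Open Scope classical_set_scope.
Local Open Scope ring_scope.

(* The plane is 'cV[R]_2, on which 2 x 2 matrices act by left multiplication:
   u = (x, y) has x = u 0 0 and y = u 1 0. *)

Section Group.
Context {R : realType}.

Definition O2 : set 'M[R]_2 := [set g | g *m g^T = 1%:M].

(* By Cartan's theorem every compact subgroup of O(2) is a Lie subgroup;
   conversely a compact Lie subgroup is a compact subset. *)
Definition compact_subgroup_O2 (G : set 'M[R]_2) :=
  [/\ G `<=` O2, compact G, G 1%:M,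
      forall g h, G g -> G h -> G (g *m h)
    & forall g, G g -> G (invmx g)].

(* A homomorphism G -> Z_2 = {1, -1}; values outside G are irrelevant. *)
Definition sign_hom (G : set 'M[R]_2) (eta : 'M[R]_2 -> R) :=
  (forall g, G g -> eta g = 1 \/ eta g = -1) /\
  (forall g h, G g -> G h -> eta (g *m h) = eta g * eta h).

End Group.

Section Smooth.
Context {R : realType}.

Fixpoint Ck (k : nat) (f : 'cV[R]_2 -> R) : Prop :=
  match k with
  | 0 => continuous f
  | k'.+1 => continuous f /\ forall i : 'I_2,
      (forall u, derivable f u (delta_mx i 0)) /\
      Ck k' (fun u => 'D_(delta_mx i 0) f u)
  end.

Definition smooth (f : 'cV[R]_2 -> R) := forall k, Ck k f.

End Smooth.

Section QuadraticDifferentialForm.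
Context {R : realType}.
Variables a b c : 'cV[R]_2 -> R.

Definition qform (u v : 'cV[R]_2) : R :=
  let dx := v 0 0 in let dy := v 1 0 in
  a u * dy ^+ 2 + 2 * b u * dx * dy + c u * dx ^+ 2.

Definition equivariant (G : set 'M[R]_2) (eta : 'M[R]_2 -> R) :=
  forall g, G g -> forall u v, qform (g *m u) (g *m v) = eta g * qform u v.

Definition discr (u : 'cV[R]_2) : R := b u ^+ 2 - a u * c u.

Definition Omega : set 'cV[R]_2 := [set u | 0 < discr u].

(* The index i ranges over {1, 2}; the other index is 3 - i. *)
Definition X (i : nat) (u : 'cV[R]_2) : 'cV[R]_2 :=
  \col_(k < 2) (if k == 0 then a u
                else - b u + (-1) ^+ i * Num.sqrt (discr u)).

Definition collinear (w v : 'cV[R]_2) := exists k : R, v = k *: w.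

(* The nonzero vectors v spanning the direction of the i-th foliation at u. *)
Definition tangent (i : nat) (u v : 'cV[R]_2) : Prop :=
  v <> 0 /\
  (X i u <> 0 -> collinear (X i u) v) /\
  (X i u = 0 -> qform u v = 0 /\ ~ collinear (X (3 - i)%N u) v).

(* Traces of regular C^1 curves in Omega, parametrized by a nonempty open
   interval and everywhere tangent to the i-th direction field. *)
Definition integral_curve (i : nat) (L : set 'cV[R]_2) : Prop :=
  exists (J : set R) (s : R -> 'cV[R]_2),
    [/\ open J, is_interval J, J !=set0, L = s @` J &
        forall t, J t ->
          [/\ Omega (s t), derivable s t 1, {for t, continuous (derive1 s)}
            & tangent i (s t) (derive1 s t)]].

(* The i-th foliation as the set of its leaves: non-oriented (hence
   unparametrized) solution curves that cannot be extended. *)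
Definition foliation (i : nat) : set (set 'cV[R]_2) :=
  [set L | integral_curve i L /\
           forall M, integral_curve i M -> L `<=` M -> M = L].

Definition image_foliation (g : 'M[R]_2) (F : set (set 'cV[R]_2)) :
    set (set 'cV[R]_2) :=
  [set mulmx g @` L | L in F].

Definition preserves_foliations (g : 'M[R]_2) :=
  image_foliation g (foliation 1) = foliation 1 /\
  image_foliation g (foliation 2) = foliation 2.

Definition interchanges_foliations (g : 'M[R]_2) :=
  image_foliation g (foliation 1) = foliation 2 /\
  image_foliation g (foliation 2) = foliation 1.

End QuadraticDifferentialForm.

(* Main.v *)
Require Import Defs.
From HB Require Import structures.
From mathcomp Require Import all_boot all_order all_algebra.
From mathcomp Require Import all_classical all_reals all_analysis.
From mathcomp Require Import ring lra.
Set Implicit Arguments.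
Unset Strict Implicit.
Unset Printing Implicit Defensive.
Import Order.TTheory GRing.Theory Num.Theory.
Import numFieldNormedType.Exports.
Local Open Scope classical_set_scope.
Local Open Scope ring_scope.

(** Write B_u for the symmetric bilinear form whose quadratic form is
    omega(u, .), and [v, w] for the oriented area of the parallelogram on v, w.
    Where delta(u) > 0, the pencil B_u - s [., .] of bilinear forms is
    degenerate exactly for s = sqrt(delta(u)) and s = - sqrt(delta(u)), and its
    left kernels at these two values are the two null directions of omega at u.
    The labelling by the vector fields X_1 and X_2 is the labelling by the sign
    of s: a nonzero vector v is tangent to the i-th foliation at u if and only if
      B_u(v, w) = (-1)^i sqrt(delta(u)) [v, w]   for all w
    (tangent_polarP). This criterion no longer mentions coordinates and covers
    the points where X_i vanishes.

    An element g of the group multiplies B by eta(g), by polarization, and the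
    area by det(g); both factors are signs. The Gram identity
      B_u(v, w)^2 - omega(u, v) omega(u, w) = delta(u) [v, w]^2
    then shows that delta is invariant (discr_mulmx), so g maps the vectors
    tangent to the i-th foliation at u to vectors satisfying the criterion at
    g u with (-1)^i multiplied by det(g) eta(g) (tangent_mulmx). Hence g
    preserves each direction field if det(g) eta(g) = 1 and exchanges them
    otherwise. Integral curves follow by the chain rule
    (integral_curve_mulmx), and maximal ones because the inverse of g has the
    same sign det * eta (image_foliationE). *)

Section PlaneVectors.
Context {R : realType}.
Implicit Types (u v w : 'cV[R]_2) (g : 'M[R]_2).

Definition area v w : R := v 0 0 * w 1 0 - v 1 0 * w 0 0.

Lemma cV2P v w : v 0 0 = w 0 0 -> v 1 0 = w 1 0 -> v = w.
Proof.
move=> e0 e1; apply/colP => k; have : (k < 2)%N := ltn_ord k.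
by case: k => -[|[|//]] k /= _; [move: e0|move: e1];
  congr (_ = _); congr (fun_of_matrix _ _ _); apply: val_inj.
Qed.

Lemma mulmx2E g v (k : 'I_2) : (g *m v) k 0 = g k 0 * v 0 0 + g k 1 * v 1 0.
Proof.
by rewrite mxE big_ord_recl big_ord1; congr (_ + g k _ * v _ _); apply: val_inj.
Qed.

Lemma sqr1_neq0 (x : R) : x ^+ 2 = 1 -> x != 0.
Proof. by apply: contra_eq_neq => ->; rewrite expr0n eq_sym oner_neq0. Qed.

Lemma area_mulmx g v w : area (g *m v) (g *m w) = \det g * area v w.
Proof.
rewrite /area !mulmx2E (expand_det_row _ 0) big_ord_recl big_ord1 /cofactor.
rewrite !det_mx11 !mxE /=.
have -> : lift 0 0 = 1 :> 'I_2 by apply: val_inj.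
have -> : lift 1 0 = 0 :> 'I_2 by apply: val_inj.
by rewrite /= addn0 addn1 expr0 expr1; ring.
Qed.

End PlaneVectors.

Section Polar.
Context {R : realType}.
Variables a b c : 'cV[R]_2 -> R.
Implicit Types (u v w : 'cV[R]_2) (g : 'M[R]_2) (i j : nat).

Definition polar u v w : R :=
  (qform a b c u (v + w) - qform a b c u v - qform a b c u w) / 2.

Lemma polarE u v w :
  polar u v w = (a u * v 1 0 + b u * v 0 0) * w 1 0
              + (b u * v 1 0 + c u * v 0 0) * w 0 0.
Proof. by rewrite /polar /qform !mxE; field. Qed.

(** The Gram determinant of two vectors for B_u is det(B_u) = - discr u times
    the square of their area. It expresses the discriminant through quantities
    whose behaviour under linear maps is evident. *)
Lemma polar_gram u v w :
  polar u v w ^+ 2 - qform a b c u v * qform a b c u w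
  = discr a b c u * area v w ^+ 2.
Proof. by rewrite polarE /qform /discr /area; ring. Qed.

(** Since v is null, B_u v is orthogonal to v, that is, a multiple of v turned
    by a right angle; the determinant of B_u forces the ratio to be a square
    root of discr u, and a computation on X i identifies its sign as (-1)^i.
    When X i u = 0 the null direction other than that of X (3 - i) is still the
    kernel for the same sign, so one criterion covers both clauses of
    tangent. *)
Lemma tangent_polarP i u v : (0 < i < 3)%N -> Omega a b c u ->
  tangent a b c i u v <->
  v <> 0 /\
  forall w, polar u v w = (-1) ^+ i * Num.sqrt (discr a b c u) * area v w.
Proof.
move=> i12 du.
have s3i : (-1) ^+ (3 - i)%N = - (-1) ^+ i :> R.
  by case: i i12 => [|[|[|i]]] //= _; rewrite ?subn1 ?subn2 /=; ring.
rewrite /tangent /collinear.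
set s := (-1) ^+ i * Num.sqrt (discr a b c u).
have ss : s ^+ 2 = b u ^+ 2 - a u * c u.
  by rewrite exprMn sqrr_sign mul1r sqr_sqrtr// ltW.
have s0 : s != 0 by rewrite mulf_neq0 ?signr_eq0// gt_eqF// sqrtr_gt0.
have Xi0 : X a b c i u 0 0 = a u by rewrite mxE.
have Xi1 : X a b c i u 1 0 = s - b u by rewrite mxE /= addrC.
have Xj0 : X a b c (3 - i) u 0 0 = a u by rewrite mxE.
have Xj1 : X a b c (3 - i) u 1 0 = - s - b u.
  by rewrite mxE /= s3i mulNr addrC.
have zE (k : R) (w : 'cV[R]_2) l : (k *: w) l 0 = k * w l 0 by rewrite mxE.
(* Testing against the two basis vectors turns the criterion into a linear
   system in v whose two equations are proportional, as s ^+ 2 = b ^+ 2 - a c. *)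
have -> : (forall w, polar u v w = s * area v w) <->
    a u * v 1 0 = (s - b u) * v 0 0 /\ c u * v 0 0 = - (s + b u) * v 1 0.
  split=> [pv|[e1 e0] w].
    have := pv (delta_mx 1 0); have := pv (delta_mx 0 0).
    by rewrite !polarE /area !mxE /=; split; lra.
  rewrite polarE /area.
  rewrite (_ : b u * _ + _ = - s * v 1 0); last by rewrite e0; ring.
  by rewrite e1; ring.
have [X0|/eqP Xn0] := eqVneq (X a b c i u) 0; last first.
  split=> [[vn0 [/(_ Xn0)[k vk] _]]|[vn0 [e1 e0]]].
    split=> //; rewrite vk !zE Xi0 Xi1.
    split; first by ring.
    have -> : c u * (k * a u) = k * (b u ^+ 2 - s ^+ 2) by rewrite ss; ring.
    by ring.
  split=> //; split=> [_|/Xn0//].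
  (* The first coordinate of X i u is a u and the second is s - b u: the
     multiplier is read off from a coordinate that does not vanish. *)
  have [au0|aun0] := eqVneq (a u) 0; last first.
    exists (v 0 0 / a u); apply: cV2P; rewrite ?zE ?Xi0 ?Xi1; first by field.
    apply: (mulfI aun0); rewrite e1; field; exact: aun0.
  have sb : s - b u != 0.
    apply/eqP => sb0; apply: Xn0.
    by apply: cV2P; rewrite ?Xi0 ?Xi1 mxE.
  exists (v 1 0 / (s - b u)); apply: cV2P; rewrite ?zE ?Xi0 ?Xi1; last by field.
  rewrite au0 mulr0; apply/eqP; move/eqP: e1.
  by rewrite au0 mul0r eq_sym mulf_eq0 (negbTE sb).
(* Here a = 0 and b = s: the null directions are the vertical one, spanned by
   X (3 - i) u = (0, - 2 s), and c x + 2 s y = 0. *)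
have au0 : a u = 0 by rewrite -Xi0 X0 mxE.
have bs : b u = s by apply/eqP; rewrite eq_sym -subr_eq0 -Xi1 X0 mxE.
split=> [[vn0 [_ /(_ X0)[qv ncol]]]|[vn0 [e1 e0]]]; split=> //.
  have x0 : v 0 0 != 0.
    apply/eqP => x0; apply: ncol; exists (v 1 0 / (- s - b u)).
    apply: cV2P; rewrite ?zE ?Xj0 ?Xj1 ?au0 ?mulr0// bs; field.
    by rewrite -opprD oppr_eq0 -mulr2n mulrn_eq0.
  rewrite au0 bs; split; first by ring.
  apply: (mulfI x0); move: qv; rewrite /qform au0 bs => qv.
  by apply/eqP; rewrite -subr_eq0 -[X in _ == X]qv; apply/eqP; ring.
split=> [//|_]; split.
  rewrite /qform au0 bs.
  have -> : c u * v 0 0 ^+ 2 = (c u * v 0 0) * v 0 0 by ring.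
  by rewrite e0 bs; ring.
move=> [k vk]; apply: vn0.
have x0 : v 0 0 = 0 by rewrite vk zE Xj0 au0 mulr0.
apply: cV2P; rewrite mxE//; apply/eqP; move/eqP: e0.
rewrite x0 mulr0 bs eq_sym mulf_eq0 oppr_eq0 -mulr2n mulrn_eq0 /=.
by rewrite (negbTE s0).
Qed.

Lemma polar_mulmx g e u :
  (forall v, qform a b c (g *m u) (g *m v) = e * qform a b c u v) ->
  forall v w, polar (g *m u) (g *m v) (g *m w) = e * polar u v w.
Proof. by move=> qg v w; rewrite /polar -mulmxDr !qg -!mulrBr mulrA. Qed.

(** On the standard basis, polar_gram reads off discr u; on its image under g
    the factors e and \det g enter only through their squares. *)
Lemma discr_mulmx g e u : \det g ^+ 2 = 1 -> e ^+ 2 = 1 ->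
  (forall v, qform a b c (g *m u) (g *m v) = e * qform a b c u v) ->
  discr a b c (g *m u) = discr a b c u.
Proof.
move=> dg ee qg; set e0 : 'cV[R]_2 := delta_mx 0 0.
set e1 : 'cV[R]_2 := delta_mx 1 0.
have area01 : area e0 e1 = 1 by rewrite /area !mxE /= mulr1 mulr0 subr0.
have := polar_gram (g *m u) (g *m e0) (g *m e1).
rewrite (polar_mulmx qg) !qg area_mulmx area01 mulr1 dg mulr1 => <-.
by rewrite exprMn ee mul1r mulrACA -expr2 ee mul1r polar_gram area01 expr1n mulr1.
Qed.

(** Transporting the criterion of tangent_polarP multiplies its left side by e
    and its area by \det g; as both are signs, moving them to one side turns
    (-1) ^+ i into \det g * e * (-1) ^+ i. *)
Lemma tangent_mulmx g e u i j v : \det g ^+ 2 = 1 -> e ^+ 2 = 1 ->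
  (forall w, qform a b c (g *m u) (g *m w) = e * qform a b c u w) ->
  (0 < i < 3)%N -> (0 < j < 3)%N -> (-1) ^+ j = \det g * e * (-1) ^+ i ->
  Omega a b c u -> tangent a b c i u v ->
  tangent a b c j (g *m u) (g *m v).
Proof.
move=> dg ee qg i12 j12 ij du /(tangent_polarP _ i12 du)[vn0 pv].
have gu : g \in unitmx by rewrite unitmxE unitfE sqr1_neq0.
have dE := discr_mulmx dg ee qg.
have dgu : Omega a b c (g *m u) by rewrite /Omega /= dE.
apply/(tangent_polarP _ j12 dgu); split=> [/(congr1 (mulmx (invmx g)))|w].
  by rewrite mulKmx// mulmx0.
rewrite -(mulKVmx gu w); move: (invmx g *m w) => {}w.
rewrite (polar_mulmx qg) area_mulmx pv dE ij.
transitivity (\det g ^+ 2 * (e * ((-1) ^+ i * Num.sqrt (discr a b c u)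
  * area v w))); last by ring.
by rewrite dg mul1r.
Qed.

End Polar.

Section LinearCurves.
Context {R : realType}.

Lemma mulmx_continuous m n (g : 'M[R]_(m, n)) :
  continuous (mulmx g : 'cV[R]_n -> 'cV[R]_m).
Proof.
have -> : (mulmx g : 'cV[R]_n -> 'cV[R]_m)
    = fun u => \sum_(j < n) u j 0 *: col j g.
  apply/funext => u; apply/colP => i; rewrite summxE mxE.
  by apply: eq_bigr => j _; rewrite !mxE mulrC.
apply: continuous_big => [|j _ u]; first exact: add_continuous.
apply: (@continuous_comp _ _ _ (fun v : 'cV[R]_n => v j 0) ( *:%R ^~ (col j g))).
  exact: coord_continuous.
exact: scalel_continuous.
Qed.

Lemma derivable_mulmx m n (g : 'M[R]_(m, n)) (s : R -> 'cV[R]_n) t :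
  derivable s t 1 -> derivable (mulmx g \o s) t 1.
Proof.
move=> /derivable1_diffP ds; apply/derivable1_diffP.
by apply: differentiable_comp ds _; apply: linear_differentiable;
  exact: mulmx_continuous.
Qed.

Lemma derive1_mulmx m n (g : 'M[R]_(m, n)) (s : R -> 'cV[R]_n) t :
  derivable s t 1 -> derive1 (mulmx g \o s) t = g *m derive1 s t.
Proof.
move=> /derivable1_diffP ds.
have cg := @mulmx_continuous m n g.
have dg : differentiable (mulmx g) (s t) by exact: linear_differentiable.
rewrite !derive1E' //; last exact: differentiable_comp.
by rewrite diff_comp //= diff_lin.
Qed.

End LinearCurves.

Section Foliations.
Context {R : realType}.
Variables a b c : 'cV[R]_2 -> R.
Implicit Types (g h : 'M[R]_2) (i j : nat).

Lemma integral_curve_mulmx g e i j L : \det g ^+ 2 = 1 -> e ^+ 2 = 1 ->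
  (forall u v, qform a b c (g *m u) (g *m v) = e * qform a b c u v) ->
  (0 < i < 3)%N -> (0 < j < 3)%N -> (-1) ^+ j = \det g * e * (-1) ^+ i ->
  integral_curve a b c i L -> integral_curve a b c j (mulmx g @` L).
Proof.
move=> dg ee qg i12 j12 ij [J [s [oJ iJ J0 -> sJ]]].
exists J, (mulmx g \o s); split=> //; first by rewrite image_comp.
move=> t Jt; have [Ost ds cs tst] := sJ t Jt; split.
- by rewrite /Omega /= (discr_mulmx dg ee (qg _)).
- exact: derivable_mulmx.
(* derive1_mulmx applies only where s is derivable, hence the continuity of
   the derivative is transferred along an equality on the neighbourhood J. *)
- have near_eq : \near t, (mulmx g \o derive1 s) t = derive1 (mulmx g \o s) t.
    near=> x; have Jx : J x by near: x; exact: open_nbhs_nbhs.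
    by have [_ dx _ _] := sJ x Jx; rewrite (derive1_mulmx g dx).
  have cgs : {for t, continuous (mulmx g \o derive1 s)}.
    by apply: continuous_comp; [exact: cs|exact: mulmx_continuous].
  rewrite /prop_for /continuous_at (derive1_mulmx g ds).
  by apply: cvg_trans cgs; apply: near_eq_cvg.
- rewrite (derive1_mulmx g ds).
  exact: (tangent_mulmx dg ee (qg (s t)) i12 j12 ij Ost tst).
Unshelve. all: by end_near. Qed.

Lemma image_mulmxK g h (L : set 'cV[R]_2) :
  g *m h = 1%:M -> mulmx g @` (mulmx h @` L) = L.
Proof.
move=> gh; rewrite image_comp -[RHS]image_id.
by apply: eq_imagel => u _ /=; rewrite mulmxA gh mul1mx.
Qed.

(** A leaf is an integral curve maximal for inclusion, so a bijection between
    the integral curves of the two fields that respects inclusion both ways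
    matches the leaves, without any knowledge of which leaves exist. *)
Lemma image_foliationE g h i j : g *m h = 1%:M ->
  (forall L, integral_curve a b c i L -> integral_curve a b c j (mulmx g @` L)) ->
  (forall L, integral_curve a b c j L -> integral_curve a b c i (mulmx h @` L)) ->
  image_foliation g (foliation a b c i) = foliation a b c j.
Proof.
move=> gh ig ih; have ghK M := image_mulmxK M gh; have hgK M := image_mulmxK M (mulmx1C gh).
apply/seteqP; split=> [_ [L [iL maxL] <-]|L [jL maxL]].
  split=> [|M jM LM]; first exact: ig.
  rewrite -(ghK M) (maxL _ (ih _ jM))// -[X in X `<=` _](hgK L).
  exact: image_subset.
exists (mulmx h @` L) => //; split=> [|M iM LM]; first exact: ih.
rewrite -(hgK M) (maxL _ (ig _ iM))// -[X in X `<=` _](ghK L).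
exact: image_subset.
Qed.

End Foliations.

Theorem theorem2p4 (R : realType) (G : set 'M[R]_2)
    (hG : compact_subgroup_O2 G)
    (eta : 'M[R]_2 -> R) (heta : sign_hom G eta)
    (a b c : 'cV[R]_2 -> R)
    (ha : smooth a) (hb : smooth b) (hc : smooth c)
    (homega : equivariant a b c G eta)
    (hOmega : Omega a b c !=set0)
    (lambda : 'M[R]_2 -> R) (hlambda : sign_hom G lambda)
    (hlambda_pres : forall g, G g ->
       preserves_foliations a b c g -> lambda g = 1)
    (hlambda_swap : forall g, G g ->
       interchanges_foliations a b c g -> lambda g = -1) :
  forall g, G g -> lambda g = \det g * eta g.
Proof.
move=> g Gg; case: hG => GO _ G1 _ GV; case: heta => eta_pm etaM.
have gg : g *m g^T = 1%:M := GO _ Gg.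
have [gu _] := mulmx1_unit gg.
have Gh := GV _ Gg; set h := invmx g in Gh.
have gh : g *m h = 1%:M by rewrite mulmxV.
have eta2 k : G k -> eta k ^+ 2 = 1.
  by move=> /eta_pm[] ->; rewrite ?sqrrN expr1n.
have dg2 : \det g ^+ 2 = 1 by rewrite expr2 -{2}det_tr -det_mulmx gg det1.
have dh : \det h = \det g.
  rewrite det_inv; have d0 := sqr1_neq0 dg2.
  by apply: (mulfI d0); rewrite -expr2 dg2 divff.
have eta1 : eta 1%:M = 1.
  by rewrite -(mulmx1 1%:M) etaM// -expr2 eta2.
have eh : eta h = eta g.
  by rewrite -[LHS]mul1r -(eta2 _ Gg) expr2 -mulrA -etaM// gh eta1 mulr1.
have transport i j : (0 < i < 3)%N -> (0 < j < 3)%N ->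
    (-1) ^+ j = \det g * eta g * (-1) ^+ i ->
    image_foliation g (foliation a b c i) = foliation a b c j.
  move=> i12 j12 ij; apply: (image_foliationE gh) => L.
    exact: (integral_curve_mulmx dg2 (eta2 _ Gg) (homega _ Gg)).
  apply: (integral_curve_mulmx _ (eta2 _ Gh) (homega _ Gh)) => //.
    by rewrite dh.
  by rewrite dh eh ij mulrA -expr2 exprMn dg2 eta2// !mul1r.
have : (\det g * eta g) ^+ 2 == 1 by rewrite exprMn dg2 eta2// mulr1.
rewrite sqrf_eq1 => /orP[] /eqP dge; rewrite dge.
  by apply: hlambda_pres => //; split; apply: transport; rewrite // dge mul1r.
apply: hlambda_swap => //.
by split; apply: transport; rewrite // dge mulN1r ?expr1 ?sqrrN ?opprK ?expr1n.
Qed.
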